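(* Let $\ell>2$. Say $\lambda\approx(\mu,r,s,\rho,\sigma)$ if: $\mu=(\mu_1,\dots,\mu_m)$ is an $\ell$-core with $\mu_1-\mu_2<\ell-1$ and $\mu'_1-\mu'_2<\ell-1$; $r,s\ge 0$ are integers; $\rho,\sigma$ are partitions with $len(\rho)\le r+1$ and $len(\sigma)\le s+1$ (parts beyond the length being $0$); if $\mu=\emptyset$ then at least one of $\rho_{r+1},\sigma_{s+1}$ is $0$; and $$\lambda=\big(s+\mu_1+r(\ell-1)+\rho_1\ell,\ s+\mu_1+(r-1)(\ell-1)+\rho_2\ell,\ \dots,\ s+\mu_1+(\ell-1)+\rho_r\ell,\ s+\mu_1+\rho_{r+1}\ell,\ s+\mu_2,\ \dots,\ s+\mu_m,\ (s+1)^{\sigma_{s+1}\ell},\ s^{\ell-1+(\sigma_s-\sigma_{s+1})\ell},\ (s-1)^{\ell-1+(\sigma_{s-1}-\sigma_s)\ell},\ \dots,\ 1^{\ell-1+(\sigma_1-\sigma_2)\ell}\big),$$ where $j^{k}$ denotes $k$ parts equal to $j$ (and $\mu_1=0$, $m=0$ if $\mu=\emptyset$). Then every $\lambda$ with $\lambda\approx(\mu,r,s,\rho,\sigma)$ for some such data is an $(\ell,0)$-JM partition, and conversely every $(\ell,0)$-JM partition $\lambda$ satisfies $\lambda\approx(\mu,r,s,\rho,\sigma)$ for some such data.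
   Context: Partitions are identified with Young diagrams; $(x,y)$ is the box in row $x$, column $y$; $\mu'$ is the transpose of $\mu$ and $len(\rho)$ the number of nonzero parts. The hook length $h^\lambda_{(a,c)}$ of a box $(a,c)\in\lambda$ is the number of boxes of $\lambda$ to its right in its row or below it in its column, including itself. An $\ell$-core is a partition none of whose hook lengths is divisible by $\ell$. $\lambda$ is an $(\ell,0)$-JM partition if there do NOT exist boxes $(a,b)$, $(a,y)$, $(x,b)$ in $\lambda$ with $\ell\mid h^\lambda_{(a,b)}$, $\ell\nmid h^\lambda_{(a,y)}$, $\ell\nmid h^\lambda_{(x,b)}$.
   Formalization: If μ=∅, s+μ_1+ρ_{r+1}ℓ is not listed as a separate part; instead ρ_{r+1}ℓ is added to the first part of the list following s+μ_m (to an empty row if there is none). Read literally, ℓ=3, r=0, s=1, ρ=(1), σ=∅ would give (4,1,1), which is not JM. *)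

(* Defs.v *)
From mathcomp Require Import all_boot.

Set Implicit Arguments.
Unset Strict Implicit.
Unset Printing Implicit Defensive.

(* Partitions are the weakly decreasing sequences of their nonzero parts.
   Rows, columns and parts are numbered from 0 here: the part usually written
   la_(i+1) is [part la i], with value 0 beyond the length. *)

Definition is_partition (la : seq nat) : bool :=
  sorted geq la && (0 \notin la).

Definition part (la : seq nat) (i : nat) : nat := nth 0 la i.

Definition box (la : seq nat) (a c : nat) : bool := c < part la a.

Definition transpose (la : seq nat) : seq nat :=
  [seq count (fun x => c < x) la | c <- iota 0 (part la 0)].

(* For a box (a, c): the part la a - c boxes (a, c') with c <= c', plus the
   boxes (a', c) with a < a'. *)
Definition hook (la : seq nat) (a c : nat) : nat :=
  (part la a - c) + count (fun x => c < x) (drop a.+1 la).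

Definition is_core (l : nat) (la : seq nat) : Prop :=
  is_partition la /\ forall a c, box la a c -> ~~ (l %| hook la a c).

Definition is_JM (l : nat) (la : seq nat) : Prop :=
  is_partition la /\
  ~ (exists a b x y : nat,
       [/\ box la a b, box la a y & box la x b] /\
       [/\ l %| hook la a b, ~~ (l %| hook la a y) & ~~ (l %| hook la x b)]).

(* (s+1)^(sigma_(s+1) l), s^(l-1+(sigma_s-sigma_(s+1)) l), ...,
   1^(l-1+(sigma_1-sigma_2) l) *)
Definition bottom_parts (l s : nat) (sigma : seq nat) : seq nat :=
  nseq (part sigma s * l) s.+1 ++
  flatten [seq nseq (l.-1 + (part sigma j.-1 - part sigma j) * l) j
          | j <- rev (iota 1 s)].

(* The first r parts are s + mu_1 + (r-i)(l-1) + rho_(i+1) l for 0 <= i < r;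
   the (r+1)-st one is s + mu_1 + rho_(r+1) l.

   If mu is empty there is no part s + mu_1 to which rho_(r+1) l could be
   added: row r+1 is then the first row of the bottom parts (an empty row if
   there are none), and it is this row that grows by rho_(r+1) l.  Listing
   s + rho_(r+1) l as an additional part would be wrong: for l = 3, mu empty,
   r = 0, s = 1, rho = (1) and sigma empty, it would give (4,1,1), which is
   not a JM partition, instead of (4,1), which is one. *)
Definition JM_parts (l : nat) (mu : seq nat) (r s : nat)
    (rho sigma : seq nat) : seq nat :=
  [seq s + part mu 0 + (r - i) * l.-1 + part rho i * l | i <- iota 0 r] ++
  match mu with
  | mu1 :: mu' =>
      (s + mu1 + part rho r * l) :: [seq s + x | x <- mu']
        ++ bottom_parts l s sigma
  | [::] =>
      let bot := bottom_parts l s sigma in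
      (part bot 0 + part rho r * l) :: behead bot
  end.

(* The filter only discards row r+1 when it is empty, which requires
   mu = [::]. *)
Definition JM_approx (l : nat) (la mu : seq nat) (r s : nat)
    (rho sigma : seq nat) : Prop :=
  [/\ is_core l mu,
      part mu 0 - part mu 1 < l.-1,
      part (transpose mu) 0 - part (transpose mu) 1 < l.-1 &
      [/\ is_partition rho, size rho <= r.+1,
          is_partition sigma & size sigma <= s.+1]] /\
  (mu = [::] -> part rho r = 0 \/ part sigma s = 0) /\
  la = [seq x <- JM_parts l mu r s rho sigma | 0 < x].

(* Main.v *)
Require Import Defs.
From mathcomp Require Import all_boot all_algebra zify ring.

(* Write R_a = la_a - a and C_c = c + 1 - la'_c in Z/l, so that l divides the
   hook length of a box (a, c) iff R_a = C_c.  Prepending a row or a column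
   shifts all these residues by 1.

   Direct part.  If the first k rows have equal R, the first t columns have
   equal C, R_0 <> C_0, and every box with R_a = C_c lies in a column of height
   <= k or in a row of length <= t, then la is JM: in the first case all hook
   lengths of the column are divisible by l, in the second all those of the
   row.  This property holds for mu with multiples of l added to its first row
   and column, and persists when columns, then rows, of the prescribed lengths
   are prepended.

   Converse.  Removing the first row or column of a JM partition leaves a JM
   partition.  If R_0 = R_1 one removes the first row (this lowers r), if
   C_0 = C_1 the first column (this lowers s).  If neither holds, the JM
   condition forces every divisible hook to lie in the part of row 0 beyond
   row 1 or in the part of column 0 beyond column 1, and shortening these two
   parts modulo l leaves the core mu. *)

Set Implicit Arguments.
Unset Strict Implicit.
Unset Printing Implicit Defensive.

Import GRing.Theory.

(** * Residues of rows and columns *)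

Arguments part : simpl never.

Definition height (la : seq nat) (c : nat) : nat := count (fun x => c < x) la.

(** The new first column is described by its excess [n] over the old one, of height [size la]: this
    excess, not the height, is what must be -1 modulo l. *)
Definition addcol (n : nat) (la : seq nat) : seq nat := map S la ++ nseq n 1.

Lemma is_partition_cons x la :
  is_partition (x :: la) = [&& part la 0 <= x, 0 < x & is_partition la].
Proof.
rewrite /is_partition in_cons negb_or /= eq_sym -lt0n.
case: la => [|y la] /=; first by rewrite andbT.
by rewrite /part /=; case: (y <= x); case: (0 < x); case: (path _ _ _).
Qed.

Lemma part_cons0 x la : part (x :: la) 0 = x. Proof. by []. Qed.
Lemma part_consS x la a : part (x :: la) a.+1 = part la a. Proof. by []. Qed.

Lemma part_behead la a : part (behead la) a = part la a.+1.
Proof. exact: nth_behead. Qed.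

Lemma part_default la a : size la <= a -> part la a = 0.
Proof. exact: nth_default. Qed.

Lemma is_partition_behead la : is_partition la -> is_partition (behead la).
Proof. by case: la => // x la; rewrite is_partition_cons => /and3P[]. Qed.

Lemma ltn_part la a c :
  is_partition la -> (c < part la a) = (a < height la c).
Proof.
elim: la a => [|x la IH] a; first by rewrite part_default.
rewrite is_partition_cons => /and3P[le_la_x _ pla].
case: (ltnP c x) => cx.
  by case: a => [|a]; rewrite ?part_consS ?part_cons0 /height /= cx ?IH.
have h0 : height la c = 0.
  have := IH 0 pla; rewrite ltnNge (leq_trans le_la_x cx) /= lt0n.
  by case: eqP.
have -> : height (x :: la) c = 0 by rewrite /height /= ltnNge cx add0n.
by case: a => [|a]; rewrite ?part_cons0 ?part_consS ?IH ?h0 // ltnNge cx.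
Qed.

Lemma part_leq la i j : is_partition la -> i <= j -> part la j <= part la i.
Proof.
move=> pla ij; rewrite leqNgt ltn_part // -leqNgt leqNgt.
apply/negP => /(leq_ltn_trans ij); rewrite -ltn_part // ltnn //.
Qed.

Lemma size_gt_part la a : is_partition la -> (0 < part la a) = (a < size la).
Proof.
elim: la a => [|x la IH] [|a] //.
- by rewrite is_partition_cons => /and3P[].
- by rewrite is_partition_cons part_consS => /and3P[_ _ /IH->].
Qed.

Lemma height0 la : is_partition la -> height la 0 = size la.
Proof.
elim: la => // x la IH; rewrite is_partition_cons => /and3P[_ x_gt0 pla].
by rewrite /height /= x_gt0 -[count _ _]/(height la 0) IH.
Qed.

Lemma height_cons x la c : height (x :: la) c = (c < x) + height la c.
Proof. by []. Qed.

(** Arm plus leg plus 1, written additively to avoid truncated subtraction. *)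
Lemma hookE la a c : is_partition la -> box la a c ->
  hook la a c + (a + c).+1 = part la a + height la c.
Proof.
move=> pla; rewrite /box => cla; rewrite /hook.
have -> : height la c = a.+1 + count (fun x => c < x) (drop a.+1 la).
  rewrite /height -{1}(cat_take_drop a.+1 la) count_cat; congr (_ + _).
  elim: la a pla cla => [|x la IH] a; first by rewrite part_default.
  case: a => [|a]; first by rewrite part_cons0 /= take0 /= => _ ->.
  rewrite is_partition_cons part_consS => /and3P[lex _ pla] cla /=.
  by rewrite IH // (leq_trans cla) // (leq_trans _ lex) // part_leq.
lia.
Qed.

Lemma addcol_cons n x la : addcol n (x :: la) = x.+1 :: addcol n la.
Proof. by []. Qed.

Lemma addcol_nil n : addcol n [::] = nseq n 1.
Proof. by []. Qed.

Lemma part_addcol n la a :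
  is_partition la -> part (addcol n la) a = part la a + (a < size la + n).
Proof.
move=> pla; rewrite /part /addcol nth_cat size_map.
case: ltnP => [alt|age]; first by rewrite (nth_map 0) // ltn_addr // addn1.
by rewrite nth_nseq nth_default // ltn_subLR //; case: ifP.
Qed.

Lemma height_addcol0 n la : height (addcol n la) 0 = size la + n.
Proof.
rewrite /height /addcol count_cat count_nseq mul1n; congr (_ + _).
by rewrite count_map (eq_count (a2 := predT)) ?count_predT.
Qed.

Lemma height_addcolS n la c : height (addcol n la) c.+1 = height la c.
Proof. by rewrite /height /addcol count_cat count_nseq count_map addn0. Qed.

Lemma size_addcol n la : size (addcol n la) = size la + n.
Proof. by rewrite size_cat size_map size_nseq. Qed.

Lemma is_partition_addcol n la :
  is_partition la -> is_partition (addcol n la).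
Proof.
elim: la => [|x la IH]; last first.
  rewrite addcol_cons !is_partition_cons.
  move=> /and3P[lex _ pla]; rewrite part_addcol // IH //= !andbT.
  by rewrite -[x.+1]addn1 leq_add ?leq_b1.
move=> _; elim: n => // n IH; rewrite addcol_nil.
rewrite -[nseq _ _]/(1 :: addcol n [::]).
by rewrite is_partition_cons IH part_addcol //= leq_b1.
Qed.

(** [n] counts the parts equal to 1, and [la'] collects the larger parts, each reduced by 1. *)
Lemma addcolP la : is_partition la ->
  exists n la', is_partition la' /\ la = addcol n la'.
Proof.
elim: la => [|x la IH]; first by exists 0, [::].
rewrite is_partition_cons => /and3P[lex x_gt0 /IH[n [la' [pla' ela]]]].
move: lex; rewrite ela part_addcol //.
case: x x_gt0 => // -[|x] _.
  case: la' pla' {ela} => [|y la'].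
    by exists n.+1, [::].
  rewrite is_partition_cons part_cons0 /= => /and3P[_ y_gt0 _]; lia.
move=> lex; exists n, (x.+1 :: la'); split => //.
rewrite is_partition_cons pla' /= andbT.
case: la' pla' lex {ela} => // y la' _; rewrite part_cons0 /= ; lia.
Qed.

Section Residues.

Variables (l : nat) (hl : 1 < l).
Local Open Scope ring_scope.

Definition rowres (la : seq nat) (a : nat) : 'Z_l := (part la a)%:R - a%:R.
Definition colres (la : seq nat) (c : nat) : 'Z_l := c.+1%:R - (height la c)%:R.

(** This uses [1 < l]: for smaller l the type ['Z_l] is Z/2. *)
Lemma Zl_dvd n : (l %| n)%N = (n%:R == 0 :> 'Z_l).
Proof. by rewrite -val_eqE /= val_Zp_nat. Qed.

Lemma Zl_l : l%:R = 0 :> 'Z_l.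
Proof. by apply/eqP; rewrite -Zl_dvd dvdnn. Qed.

Lemma Zl_predl : l.-1%:R = -1 :> 'Z_l.
Proof. by apply/eqP; rewrite -subr_eq0 opprK natr1 prednK ?Zl_l //; lia. Qed.

Lemma Zl_Ml n : (n * l)%:R = 0 :> 'Z_l.
Proof. by rewrite natrM Zl_l mulr0. Qed.

Lemma dvd_hook la a c : is_partition la -> box la a c ->
  (l %| hook la a c)%N = (rowres la a == colres la c).
Proof.
move=> pla bac; rewrite Zl_dvd -[RHS]subr_eq0 /rowres /colres; congr (_ == 0).
have := congr1 (fun n => n%:R : 'Z_l) (hookE pla bac).
move: (hook la a c) (part la a) (height la c) => h p q.
rewrite !natrD -!natr1 natrD => e.
by rewrite (canRL (addrK _) e); ring.
Qed.

Lemma rowres_cons0 x la : rowres (x :: la) 0 = x%:R.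
Proof. by rewrite /rowres subr0. Qed.

Lemma rowres_consS x la a : rowres (x :: la) a.+1 = rowres la a - 1.
Proof. by rewrite /rowres part_consS -natr1; ring. Qed.

Lemma colres_cons x la c : (c < x)%N -> colres (x :: la) c = colres la c - 1.
Proof. by rewrite /colres height_cons => ->; rewrite natrD /=; ring. Qed.

Lemma rowres_addcol n la a : is_partition la -> (a < size la + n)%N ->
  rowres (addcol n la) a = rowres la a + 1.
Proof. by move=> pla an; rewrite /rowres part_addcol // an natrD /=; ring. Qed.

Lemma colres_addcolS n la c : colres (addcol n la) c.+1 = colres la c + 1.
Proof. by rewrite /colres height_addcolS -natr1; ring. Qed.

Lemma colres_addcol0 n la : is_partition la ->
  colres (addcol n la) 0 = colres la 0 - n%:R.
Proof.
by move=> pla; rewrite /colres height_addcol0 height0 // natrD; ring.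
Qed.

(* In [cert_box], [part la k <= c] says that column c lies in the first k rows,
   and [part la a <= t] that row a lies in the first t columns. *)
Record certificate (la : seq nat) (k t : nat) : Prop := Certificate {
  cert_partition : is_partition la;
  cert_row : forall a, (a < k)%N -> rowres la a = rowres la 0;
  cert_col : forall c, (c < t)%N -> colres la c = colres la 0;
  cert_corner : (0 < k)%N -> (0 < t)%N -> rowres la 0 != colres la 0;
  cert_box : forall a c, (c < part la a)%N -> rowres la a = colres la c ->
    (part la k <= c)%N \/ (part la a <= t)%N }.

Lemma cert_JM la k t : certificate la k t -> is_JM l la.
Proof.
case=> pla hr hc _ hb; split=> // -[a [b [x [y [[bab bay bxb] []]]]]].
rewrite !dvd_hook // => /eqP eab nay nxb.
case: (hb a b bab eab) => [kb|ta].
  have lt_k i : (b < part la i)%N -> (i < k)%N.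
    by move=> bi; rewrite ltnNge; apply: contraL kb => /(part_leq pla); lia.
  by case/eqP: nxb; rewrite -eab (hr x) ?(hr a) //; apply: lt_k.
have lt_t i : (i < part la a)%N -> (i < t)%N by lia.
by case/eqP: nay; rewrite eab (hc y) ?(hc b) //; apply: lt_t.
Qed.

(** The last hypothesis gives the new row the residue of the first k rows after their shift. For k =
    0 there are no such rows; then [part la 0 <= t] ensures that all columns of [la] carry the
    common residue, which the new row avoids. *)
Lemma cert_cons x la k t : certificate la k t -> (0 < x)%N ->
    (part la 0 <= x)%N -> (t <= x)%N ->
    ((0 < t)%N -> x%:R != colres la 0 - 1) ->
    (if k is 0 then (part la 0 <= t)%N else x%:R == rowres la 0 - 1) ->
  certificate (x :: la) k.+1 t.
Proof.
case=> pla hr hc hcor hb x_gt0 lex tx hx hk.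
have colS c : (c < t)%N -> colres (x :: la) c = colres la 0 - 1.
  by move=> ct; rewrite colres_cons ?hc //; lia.
split; first by rewrite is_partition_cons lex x_gt0.
- case=> // a ak; rewrite rowres_consS rowres_cons0.
  by case: k {hcor hb} hr hk ak => // k hr /eqP-> ak; rewrite hr.
- by move=> c ct; rewrite !colS //; lia.
- by move=> _ t_gt0; rewrite rowres_cons0 colS ?hx.
case=> [|a] c; last first.
  rewrite !part_consS rowres_consS => ca.
  rewrite colres_cons; last by have := part_leq pla (leq0n a); lia.
  by move/addIr; apply: hb.
rewrite !part_consS part_cons0 => cx.
rewrite rowres_cons0 colres_cons // => e.
case: (ltnP c (part la k)) => [ck|]; last by left.
case: k hr hcor hb hk ck => [|k] hr hcor hb hk ck.
  by move: (hx ltac:(lia)); rewrite e hc ?eqxx //; lia.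
have cla : (c < part la 0)%N by have := part_leq pla (leq0n k.+1); lia.
move/eqP: hk; rewrite e => /addIr /esym e0.
(* The box (0, c) of [la] satisfies the same equation. Column c is too high for the first
   alternative; the second gives c < t, against the corner condition. *)
case: (hb _ _ cla e0) => ?; first lia.
by case/eqP: (hcor isT ltac:(lia)); rewrite e0 hc //; lia.
Qed.

(** As n = -1, the new column gets the residue C_0 + 1 of its shifted neighbours. All columns are
    prepended before the r upper rows, so only k <= 1 occurs. *)
Lemma cert_addcol n la k t : certificate la k t -> (0 < t)%N -> (k <= 1)%N ->
  n%:R = -1 :> 'Z_l -> (0 < n)%N -> certificate (addcol n la) k t.+1.
Proof.
case=> pla hr hc hcor hb t_gt0 k1 en n_gt0.
have col0 : colres (addcol n la) 0 = colres la 0 + 1.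
  by rewrite colres_addcol0 // en opprK.
split; first exact: is_partition_addcol.
- by case=> // a; lia.
- by case=> // c ct; rewrite colres_addcolS col0 hc.
- move=> k_gt0 _; rewrite col0 rowres_addcol //; last lia.
  by rewrite (inj_eq (addIr _)) hcor.
move=> a; rewrite !part_addcol //; case: (ltnP a) => [an|]; last first.
  by move=> ?; rewrite part_default //; lia.
rewrite rowres_addcol // => -[|c].
  rewrite col0 => _ /addIr ea.
  case: (ltnP 0 (part la a)) => [a_gt0|]; last by right; lia.
  case: (hb a 0 a_gt0 ea) => ?; last by right; lia.
  have ak : (a < k)%N.
    by rewrite ltnNge; apply/negP => /(part_leq pla); lia.
  have a0 : a = 0 by lia.
  by subst a; case/eqP: (hcor ak t_gt0).
rewrite colres_addcolS => ca /addIr /hb[|?|?]; first lia; last by right; lia.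
by left; case: (_ < _)%N; lia.
Qed.

End Residues.

(** * Partitions with prescribed data are JM *)

(** The old bottom parts grow by 1, and the appended ones form the last block. The sequences are
    related pointwise because [x :: sigma] is not a partition when x = 0. *)
Lemma bottom_partsS l s sigma sigma' :
  (forall i, part sigma' i.+1 = part sigma i) ->
  bottom_parts l s.+1 sigma' =
    addcol (l.-1 + (part sigma' 0 - part sigma 0) * l) (bottom_parts l s sigma).
Proof.
move=> es; rewrite /bottom_parts /addcol map_cat map_nseq es -catA.
congr (_ ++ _).
have -> : iota 1 s.+1 = 1 :: iota (1 + 1) s by [].
rewrite iotaDl rev_cons map_rcons flatten_rcons.
rewrite -es /=; congr (_ ++ _).
rewrite map_flatten -!map_rev -!map_comp; congr flatten; apply/eq_in_map => j.
rewrite mem_rev mem_iota /= => /andP[j_gt0 _].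
by rewrite map_nseq add1n /= es -{1}(prednK j_gt0) es.
Qed.

Lemma bottom_parts0 l sigma :
  bottom_parts l 0 sigma = nseq (part sigma 0 * l) 1.
Proof. exact: cats0. Qed.

Lemma bottom_parts_gt0 l s sigma : all (leq 1) (bottom_parts l s sigma).
Proof.
rewrite all_cat all_nseq orbT /=.
apply/allP => x /flattenP[y /mapP[j]].
by rewrite mem_rev mem_iota => /andP[j_gt0 _] -> /nseqP[->].
Qed.

Definition JM_rows l mu r s rho sigma : seq nat :=
  [seq x <- JM_parts l mu r s rho sigma | 0 < x].

Lemma JM_rows_cons l mu r s rho rho' sigma : 1 < l ->
  (forall i, part rho' i.+1 = part rho i) ->
  JM_rows l mu r.+1 s rho' sigma =
    (s + part mu 0 + r.+1 * l.-1 + part rho' 0 * l) ::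
      JM_rows l mu r s rho sigma.
Proof.
move=> hl er; rewrite /JM_rows /JM_parts.
have -> : iota 0 r.+1 = 0 :: iota (1 + 0) r by [].
rewrite iotaDl map_cons cat_cons /= subn0.
rewrite ifT; last by rewrite !addn_gt0 muln_gt0 -subn1 subn_gt0 hl !orbT.
congr (_ :: [seq _ <- _ ++ _ | _]); last by rewrite er.
by rewrite -map_comp; apply: eq_map => i /=; rewrite add1n subSS er.
Qed.

Lemma JM_rows0_cons l m mu s rho sigma : is_partition (m :: mu) ->
  JM_rows l (m :: mu) 0 s rho sigma =
    (s + m + part rho 0 * l) :: [seq s + x | x <- mu] ++ bottom_parts l s sigma.
Proof.
rewrite is_partition_cons => /and3P[_ m_gt0 /andP[_ mu_gt0]].
rewrite /JM_rows /JM_parts cat0s; apply/all_filterP.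
rewrite /= all_cat bottom_parts_gt0 andbT; apply/andP; split; first by lia.
apply/allP => _ /mapP[x x_mu ->]; rewrite addn_gt0; apply/orP; right.
by rewrite lt0n; apply: contra mu_gt0 => /eqP <-.
Qed.

Lemma JM_rows0_nil l s rho sigma :
  0 < part rho 0 * l \/ 0 < part (bottom_parts l s sigma) 0 ->
  JM_rows l [::] 0 s rho sigma =
    (part (bottom_parts l s sigma) 0 + part rho 0 * l) ::
      behead (bottom_parts l s sigma).
Proof.
move=> h; rewrite /JM_rows /JM_parts cat0s; apply/all_filterP.
have := bottom_parts_gt0 l s sigma; case: (bottom_parts _ _ _) h => [|x b] /=.
  by rewrite /part /=; lia.
by rewrite part_cons0 => _ /andP[? ->]; rewrite andbT; lia.
Qed.

Lemma JM_rows0_bottom l s rho sigma : part rho 0 = 0 ->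
  JM_rows l [::] 0 s rho sigma = bottom_parts l s sigma.
Proof.
rewrite /JM_rows /JM_parts cat0s => ->; rewrite addn0.
have := bottom_parts_gt0 l s sigma; case: (bottom_parts _ _ _) => //= x b.
rewrite part_cons0 => /andP[x_gt0 b_gt0].
by rewrite x_gt0; congr (_ :: _); apply/all_filterP.
Qed.

(** The side condition excludes a nonempty row r+1 with [mu] and the bottom parts empty. There
    [addcol] puts all the new ones below row r+1, whereas the formula merges the first of them into
    that row and so has one row fewer. *)
Lemma JM_rows_addcol l mu r s rho sigma sigma' : 1 < l -> is_partition mu ->
  (forall i, part sigma' i.+1 = part sigma i) ->
  (mu != [::]) || (bottom_parts l s sigma != [::]) || (part rho r == 0) ->
  JM_rows l mu r s.+1 rho sigma' =
    addcol (l.-1 + (part sigma' 0 - part sigma 0) * l)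
      (JM_rows l mu r s rho sigma).
Proof.
move=> hl pmu es; elim: r rho => [|r IH] rho; last first.
  rewrite -part_behead => h.
  have eb i : part rho i.+1 = part (behead rho) i by rewrite part_behead.
  rewrite !(@JM_rows_cons l mu r _ (behead rho) rho _ hl eb) (IH _ h).
  by rewrite addcol_cons !addSn.
case: mu pmu => [|m mu] pmu; last first.
  rewrite !JM_rows0_cons // (bottom_partsS _ _ es) => _.
  by rewrite /addcol /= map_cat -!catA -map_comp.
rewrite /= => h; have [r0|r_gt0] := posnP (part rho 0).
  by rewrite !JM_rows0_bottom // (bottom_partsS _ _ es).
have b_gt0 : 0 < part (bottom_parts l s sigma) 0.
  have := bottom_parts_gt0 l s sigma; move: h.
by case: (bottom_parts _ _ _) => [/= /eqP|x b _ /andP[]//]; lia.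
rewrite !JM_rows0_nil //; try by right; rewrite // (bottom_partsS _ _ es);
  case: bottom_parts b_gt0.
by rewrite (bottom_partsS _ _ es); case: bottom_parts b_gt0.
Qed.

Lemma part_cat_ones mu n a :
  size mu <= a -> part (mu ++ nseq n 1) a <= 1.
Proof.
move=> ea; rewrite /part nth_cat ltnNge ea /= nth_nseq; by case: ifP.
Qed.

(** * Certificates for the listed partitions *)

Section Certificates.

Variables (l : nat) (hl : 2 < l).
Let hl1 : 1 < l := ltnW hl.
Local Open Scope ring_scope.

Lemma Zl_predl_Ml n : (l.-1 + n * l)%:R = -1 :> 'Z_l.
Proof. by rewrite natrD Zl_predl // Zl_Ml // addr0. Qed.

Lemma predl_Ml_gt0 n : (0 < l.-1 + n * l)%N.
Proof. by rewrite ltn_addr //; lia. Qed.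

Lemma is_core_box mu a c : is_core l mu -> (c < part mu a)%N ->
  rowres l mu a != colres l mu c.
Proof. by case=> pmu cmu ca; rewrite -dvd_hook // cmu. Qed.

Lemma is_partition_ones mu n :
  is_partition mu -> is_partition (mu ++ nseq n 1%N).
Proof.
elim: mu => [_|x mu IH].
  exact: (is_partition_addcol n (isT : is_partition [::])).
rewrite cat_cons !is_partition_cons => /and3P[ex x_gt0 pmu].
rewrite x_gt0 IH // !andbT.
by case: mu ex {IH pmu} => //; case: n.
Qed.

Lemma rowres_extend m mu p q a : (a <= size mu)%N ->
  rowres l ((m + p * l)%N :: mu ++ nseq (q * l) 1%N) a = rowres l (m :: mu) a.
Proof.
case: a => [|a] ha; first by rewrite !rowres_cons0 natrD Zl_Ml // addr0.
by rewrite !rowres_consS /rowres /part nth_cat ha.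
Qed.

Lemma colres_extend m mu p q c : (c < m)%N ->
  colres l ((m + p * l)%N :: mu ++ nseq (q * l) 1%N) c = colres l (m :: mu) c.
Proof.
move=> cm; rewrite !colres_cons ?ltn_addr //; congr (_ - _).
rewrite /colres /height count_cat count_nseq; congr (_ - _).
by rewrite natrD mulnA Zl_Ml // addr0.
Qed.

(** Adding multiples of l to the first row and column preserves the residues of the core, so its
    boxes still have no divisible hook. The added boxes lie in columns of height 1 or in rows of
    length 1. *)
Lemma cert_core m mu p q : is_core l (m :: mu) ->
  certificate l ((m + p * l)%N :: mu ++ nseq (q * l) 1%N) 1 1.
Proof.
move=> cmu; have := cmu.1; rewrite is_partition_cons => /and3P[lem m_gt0 pmu].
have lem1 : (part (mu ++ nseq (q * l) 1%N) 0 <= m)%N.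
  by case: (mu) lem => //=; case: (q * l)%N.
have box0 c : (c < m)%N -> rowres l (m :: mu) 0 != colres l (m :: mu) c.
  by move=> cm; apply: is_core_box.
split.
- rewrite is_partition_cons is_partition_ones // andbT; lia.
- by case.
- by case.
- by rewrite rowres_extend // colres_extend // box0.
case=> [|a] c.
  rewrite part_consS rowres_extend // => _ e.
  case: (ltnP c (part (mu ++ nseq (q * l) 1%N) 0)) => [cp|]; last by left.
  have cm := leq_trans cp lem1.
  by move: e; rewrite colres_extend // => /eqP; rewrite (negPf (box0 _ cm)).
rewrite !part_consS => cpa; case: (ltnP a (size mu)) => [amu|mua]; last first.
  by right; apply: part_cat_ones.
have epa : part (mu ++ nseq (q * l) 1%N) a = part mu a.
  by rewrite /part nth_cat amu.
rewrite epa in cpa *; have am := part_leq pmu (leq0n a).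
rewrite rowres_extend // colres_extend; last by lia.
by move/eqP; rewrite (negPf (is_core_box cmu _)).
Qed.

(** All columns share the residue s+1, and no row is longer than t = s+1, so k = 0 suffices. Column
    s has height sigma_(s+1) l, hence this residue even when it is empty. *)
Lemma cert_bottom s sigma :
  [/\ certificate l (bottom_parts l s sigma) 0 s.+1,
      colres l (bottom_parts l s sigma) 0 = s.+1%:R
    & (part (bottom_parts l s sigma) 0 <= s.+1)%N].
Proof.
elim: s sigma => [|s IH] sigma.
  have p1 a : (part (nseq (part sigma 0 * l) 1%N) a <= 1)%N.
    by rewrite /part nth_nseq; case: ifP.
  rewrite bottom_parts0; split => //; last first.
    by rewrite /colres /height count_nseq mul1n Zl_Ml // subr0.
  split => //; first exact: (is_partition_addcol _ (isT : is_partition [::])).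
    by case.
  by move=> a c _ _; right.
have es i : part sigma i.+1 = part (behead sigma) i by rewrite part_behead.
rewrite (bottom_partsS _ _ es); have [cb col0 part0] := IH (behead sigma).
have pb := cert_partition cb.
split.
- by apply: cert_addcol; rewrite ?Zl_predl_Ml ?predl_Ml_gt0.
- by rewrite colres_addcol0 // col0 Zl_predl_Ml opprK natr1.
- by rewrite part_addcol // -[s.+2]addn1 leq_add ?leq_b1.
Qed.

Lemma cert_rows0_core m mu s rho sigma : is_core l (m :: mu) ->
  certificate l (JM_rows l (m :: mu) 0 s rho sigma) 1 s.+1.
Proof.
move=> cmu; elim: s sigma => [|s IH] sigma.
  rewrite JM_rows0_cons ?cmu.1 // bottom_parts0 add0n.
  by rewrite (eq_map (g := id)) ?map_id //; apply: cert_core.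
have es i : part sigma i.+1 = part (behead sigma) i by rewrite part_behead.
rewrite (JM_rows_addcol _ _ es) ?cmu.1 //.
by apply: cert_addcol; rewrite ?Zl_predl_Ml ?predl_Ml_gt0.
Qed.

Lemma part_bottom0 s sigma : part sigma s = 0%N ->
  part (bottom_parts l s sigma) 0 = s.
Proof.
elim: s sigma => [|s IH] sigma sig0; first by rewrite bottom_parts0 sig0.
have es i : part sigma i.+1 = part (behead sigma) i by rewrite part_behead.
have [/cert_partition pb _ _] := cert_bottom s (behead sigma).
rewrite (bottom_partsS _ _ es) part_addcol // IH -?es //.
by rewrite ltn_addl ?predl_Ml_gt0 // addn1.
Qed.

(** Here t = s instead of s+1: the extended first row puts one box into column s, whose residue
    drops to s. The cases s = 0 and s = 1 are treated directly, since [cert_addcol] requires a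
    positive t. *)
Lemma cert_rows0_nil s rho sigma : (0 < part rho 0)%N -> part sigma s = 0%N ->
  certificate l (JM_rows l [::] 0 s rho sigma) 1 s.
Proof.
move=> r_gt0.
have rl_gt0 : (0 < part rho 0 * l)%N by rewrite muln_gt0 r_gt0 ltnW.
elim: s sigma => [|s IH] sigma sig0.
  rewrite JM_rows0_nil; last by left.
  rewrite bottom_parts0 sig0 /= add0n; split=> //; try by case.
    by rewrite is_partition_cons /part /= rl_gt0.
  move=> [|a] c; first by left.
  by rewrite part_consS part_default.
have es i : part sigma i.+1 = part (behead sigma) i by rewrite part_behead.
rewrite es in sig0.
case: s IH sig0 => [_|s IH] sig0; last first.
  rewrite (JM_rows_addcol _ _ es) //; last first.
    by have := part_bottom0 sig0; case: bottom_parts.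
  by apply: (cert_addcol _ (IH _ sig0)); rewrite ?Zl_predl_Ml ?predl_Ml_gt0.
rewrite JM_rows0_nil; last by left.
rewrite (bottom_partsS _ _ es) bottom_parts0 sig0 subn0 mul0n addcol_nil.
set n := (l.-1 + _)%N; have en : n = n.-1.+1 by rewrite prednK // predl_Ml_gt0.
rewrite en /= part_cons0.
have p1 a : (part (nseq n.-1 1%N) a <= 1)%N.
  by rewrite /part nth_nseq; case: ifP.
(* Since n = -1, C_0 = 1 - n = 2, while R_0 = 1. *)
have corner : rowres l ((1 + part rho 0 * l)%N :: nseq n.-1 1%N) 0 !=
    colres l ((1 + part rho 0 * l)%N :: nseq n.-1 1%N) 0.
  rewrite rowres_cons0 natrD Zl_Ml // /colres /height /= count_nseq.
  have en1 : n.-1%:R + 1 = -1 :> 'Z_l by rewrite natr1 -en Zl_predl_Ml.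
  rewrite addr0 [X in (_ + X)%N](mul1n n.-1) add1n -[n.-1.+1%:R]natr1 en1 opprK.
  by rewrite -subr_eq0 opprD addNKr oppr_eq0 oner_neq0.
split => //; try by case.
- rewrite is_partition_cons (is_partition_addcol _ (isT : is_partition [::])).
  by rewrite andbT; move: (p1 0%N); lia.
move=> [|a] c; last by rewrite part_consS => _ _; right.
rewrite part_consS part_cons0 => _ e.
case: (ltnP c (part (nseq n.-1 1%N) 0)) => [c0|]; last by left.
have {c0} c0 : c = 0%N by have := p1 0%N; lia.
by subst c; rewrite e eqxx in corner.
Qed.

Lemma cert_row_step la k t d :
  certificate l la k t -> (0 < k)%N -> (t <= part la 0)%N ->
  certificate l ((part la 0 + l.-1 + d * l)%N :: la) k.+1 t.
Proof.
move=> cla k_gt0 tla.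
have ex : (part la 0 + l.-1 + d * l)%:R = rowres l la 0 - 1 :> 'Z_l.
  by rewrite -addnA natrD Zl_predl_Ml /rowres subr0.
apply: cert_cons => //; try lia; rewrite ex.
  by move=> t_gt0; rewrite (inj_eq (addIr _)) (cert_corner cla).
by case: (k) k_gt0.
Qed.

(** The length of the first row is carried through the induction because the row prepended next is
    compared with it. *)
Lemma cert_rows mu r s rho sigma : is_core l mu -> is_partition rho ->
  (mu = [::] -> (0 < part rho r)%N /\ part sigma s = 0%N) ->
  let la := JM_rows l mu r s rho sigma in
  certificate l la r.+1 (s + (mu != [::])) /\
  part la 0 = (s + part mu 0 + r * l.-1 + part rho 0 * l)%N.
Proof.
move=> cmu; elim: r rho => [|r IH] rho prho hmu /=.
  case: mu cmu hmu => [|m mu] cmu hmu; last first.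
    rewrite addn1; split; first exact: cert_rows0_core.
    by rewrite JM_rows0_cons ?cmu.1 // !part_cons0 mul0n addn0.
  have [r_gt0 sig0] := hmu erefl; split.
    by rewrite addn0; apply: cert_rows0_nil.
  rewrite JM_rows0_nil; last by left; rewrite muln_gt0 r_gt0 ltnW.
  rewrite part_cons0 [part [::] 0]part_default // addn0 mul0n addn0.
  by rewrite part_bottom0.
have er i : part rho i.+1 = part (behead rho) i by rewrite part_behead.
rewrite (@JM_rows_cons l mu r _ (behead rho) rho _ hl1 er) part_cons0.
have [] := IH (behead rho); rewrite ?is_partition_behead //.
  by rewrite -er.
move: (JM_rows _ _ _ _ _ _) => la cla ela.
have le_rho : (part (behead rho) 0 <= part rho 0)%N by rewrite -er part_leq.
have -> : (s + part mu 0 + r.+1 * l.-1 + part rho 0 * l)%N =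
   (part la 0 + l.-1 + (part rho 0 - part (behead rho) 0) * l)%N.
  have {1}-> : part rho 0 =
      (part (behead rho) 0 + (part rho 0 - part (behead rho) 0))%N.
    by rewrite subnKC.
  by rewrite ela mulnDl mulSn; ring.
split => //; apply: cert_row_step => //; rewrite ela -!addnA leq_add2l.
case: (mu) cmu => // m mu' [] /=; rewrite is_partition_cons part_cons0.
by move=> /and3P[_ m_gt0 _] _; rewrite ltn_addr.
Qed.

(** The induction starts from the bottom parts alone, which have k = 0; hence k = r here. For r = 0
    the first row may have length s or s+1, so its length is only given for r > 0. *)
Lemma cert_rows_nil r s rho sigma : is_partition rho -> part rho r = 0%N ->
  let la := JM_rows l [::] r s rho sigma in
  certificate l la r s.+1 /\
  ((0 < r)%N -> part la 0 = (s + r * l.-1 + part rho 0 * l)%N).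
Proof.
elim: r rho => [|r IH] rho prho rho0 /=; first by
  rewrite JM_rows0_bottom //; have [] := cert_bottom s sigma.
have er i : part rho i.+1 = part (behead rho) i by rewrite part_behead.
rewrite (@JM_rows_cons l [::] r _ (behead rho) rho _ hl1 er) part_cons0.
rewrite [part [::] 0]part_default // addn0; split => //.
have []:= IH (behead rho); rewrite ?is_partition_behead // -?er //.
case: r {IH} rho0 => [|r] rho0.
  rewrite JM_rows0_bottom -?er // => _ _.
  have [cb col0 part0] := cert_bottom s sigma.
  have ls : (s.+1 <= s + 1 * l.-1 + part rho 0 * l)%N.
    by rewrite -addnA mul1n -addn1 leq_add2l predl_Ml_gt0.
  have ex : (s + 1 * l.-1 + part rho 0 * l)%:R = s%:R - 1 :> 'Z_l.
    by rewrite -addnA natrD mul1n Zl_predl_Ml.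
  move: ls ex; set x := (_ + _ * l)%N => ls ex; apply: cert_cons => //; try lia.
  (* The corner condition: the new row has residue s-1, the shifted columns have residue s. *)
  rewrite ex col0 -natr1 addrK => _.
  by rewrite eq_sym -subr_eq0 opprB addrC subrK oner_neq0.
move: (JM_rows _ _ _ _ _ _) => la cla ela.
have le_rho : (part (behead rho) 0 <= part rho 0)%N by rewrite -er part_leq.
have -> : (s + r.+2 * l.-1 + part rho 0 * l)%N =
   (part la 0 + l.-1 + (part rho 0 - part (behead rho) 0) * l)%N.
  have {1}-> : part rho 0 =
      (part (behead rho) 0 + (part rho 0 - part (behead rho) 0))%N.
    by rewrite subnKC.
  by rewrite ela // er mulnDl !mulSn; ring.
apply: cert_row_step => //; rewrite ela // mulSn -!addnA -addn1 leq_add2l.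
by rewrite ltn_addr //; lia.
Qed.

Lemma approx_JM la mu r s rho sigma :
  JM_approx l la mu r s rho sigma -> is_JM l la.
Proof.
case=> [[cmu _ _ [prho _ _ _]] [hmu ->]].
rewrite -/(JM_rows l mu r s rho sigma).
have [r0|r_gt0] := posnP (part rho r).
  case: mu cmu hmu => [|m mu] cmu hmu.
    by have [c _] := cert_rows_nil s sigma prho r0; apply: cert_JM c.
  by have [|c _] := @cert_rows _ r s rho sigma cmu prho; last apply: cert_JM c.
have [|c _] := @cert_rows _ r s rho sigma cmu prho; last by apply: cert_JM c.
by move=> /hmu[|-> //]; lia.
Qed.

End Certificates.

(** * Removing a row or a column *)

Lemma part_transpose mu c :
  is_partition mu -> part (transpose mu) c = height mu c.
Proof.
move=> pmu; rewrite /part /transpose; case: (ltnP c (part mu 0)) => hc.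
  by rewrite (nth_map 0) ?size_iota // nth_iota.
rewrite nth_default ?size_map ?size_iota //.
by move: (ltn_part 0 c pmu); rewrite ltnNge hc; case: height.
Qed.

(* [consp] avoids the forbidden zero parts: x = 0 only occurs when all later
   parts vanish too. *)
Definition consp (x : nat) (rho : seq nat) : seq nat :=
  if x is 0 then [::] else x :: rho.

Lemma consp_spec x rho : is_partition rho -> part rho 0 <= x ->
  [/\ is_partition (consp x rho), size (consp x rho) <= (size rho).+1,
      part (consp x rho) 0 = x
    & forall i, part (consp x rho) i.+1 = part rho i].
Proof.
case: x => [|x] prho lex; split => //=.
  move=> i; apply/esym/eqP; rewrite -leqn0; apply: leq_trans lex.
  exact: part_leq.
by rewrite is_partition_cons lex.
Qed.

Section Converse.

Variables (l : nat) (hl : 2 < l).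
Let hl1 : 1 < l := ltnW hl.
Local Open Scope ring_scope.

Lemma Zl_eqN1 n : n%:R = -1 :> 'Z_l -> exists d, n = (l.-1 + d * l)%N.
Proof.
move/eqP; rewrite -subr_eq0 opprK natr1 -Zl_dvd // => /dvdnP[[|d]]; first lia.
by rewrite mulSn => e; exists d; lia.
Qed.

(** Used to shorten the first row and column: the quotient q becomes a part of [rho] or [sigma], the
    remainder e stays in the core. *)
Lemma Zl_neqN1 n : n%:R != -1 :> 'Z_l ->
  exists q e, n = (e + q * l)%N /\ (e < l.-1)%N.
Proof.
move=> n1; exists (n %/ l)%N, (n %% l)%N.
rewrite addnC -divn_eq; split => //.
have := ltn_pmod n (ltnW hl1); rewrite -{2}(ltn_predK hl) ltnS leq_eqVlt.
case/orP => // /eqP e; case/eqP: n1.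
have -> : n = (l.-1 + n %/ l * l)%N by rewrite -e addnC -divn_eq.
exact: Zl_predl_Ml.
Qed.

Lemma Zl_add1_neq (x : 'Z_l) : x + 1 != x.
Proof. by rewrite -subr_eq0 addrAC subrr add0r oner_neq0. Qed.

Lemma JM_residue la a b x y : is_JM l la ->
  (b < part la a)%N -> (y < part la a)%N -> (b < part la x)%N ->
  rowres l la a = colres l la b ->
  rowres l la a = colres l la y \/ rowres l la x = colres l la b.
Proof.
case=> pla jm bab bay bxb e.
have [e1|n1] := eqVneq (rowres l la a) (colres l la y); first by left.
have [e2|n2] := eqVneq (rowres l la x) (colres l la b); first by right.
by case: jm; exists a, b, x, y; rewrite !dvd_hook // n1 n2 e eqxx.
Qed.

Lemma residue_JM la : is_partition la ->
  (forall a b x y, (b < part la a)%N -> (y < part la a)%N ->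
    (b < part la x)%N -> rowres l la a = colres l la b ->
    rowres l la a = colres l la y \/ rowres l la x = colres l la b) ->
  is_JM l la.
Proof.
move=> pla h; split=> // -[a [b [x [y [[bab bay bxb] []]]]]].
rewrite !dvd_hook // => /eqP e n1 n2.
by case: (h a b x y bab bay bxb e) => e'; [case/eqP: n1 | case/eqP: n2].
Qed.

Lemma JM_behead x la : is_JM l (x :: la) -> is_JM l la.
Proof.
move=> [pla jm]; split; first exact: is_partition_behead pla.
by move=> [a [b [z [y h]]]]; apply: jm; exists a.+1, b, z.+1, y.
Qed.

(** The boxes of [la] reappear one column further right, where row and column residues are both
    larger by 1. *)
Lemma JM_addcol n la : is_partition la -> is_JM l (addcol n la) -> is_JM l la.
Proof.
move=> pla jm; apply: residue_JM => // a b x y bab bay bxb e.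
have sz i c : (c < part la i)%N -> (i < size la)%N.
  by move=> ci; rewrite -size_gt_part // (leq_ltn_trans _ ci).
have bx i c : (c < part la i)%N -> (c.+1 < part (addcol n la) i)%N.
  by move=> ci; rewrite part_addcol // (ltn_addr _ (sz i c ci)) addn1.
have rw i c : (c < part la i)%N -> rowres l (addcol n la) i = rowres l la i + 1.
  by move=> ci; rewrite rowres_addcol // ltn_addr // (sz i c).
have := JM_residue jm (bx _ _ bab) (bx _ _ bay) (bx _ _ bxb).
rewrite !colres_addcolS (rw _ _ bab) (rw _ _ bxb) e => /(_ erefl).
by case=> /addIr; [left | right].
Qed.

(** The second hypothesis excludes a first row that is a bottom part of length s+1. *)
Lemma part0_approx la mu r s rho sigma :
    JM_approx l la mu r s rho sigma ->
    (mu = [::] -> r = 0%N -> part sigma s = 0%N) ->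
  part la 0 = (s + part mu 0 + r * l.-1 + part rho 0 * l)%N.
Proof.
case=> [[cmu _ _ [prho _ _ _]] [hmu ->]] hs.
rewrite -/(JM_rows l mu r s rho sigma).
have [[e0 r0]|h] : (mu = [::] /\ part rho r = 0%N) \/
    (mu = [::] -> (0 < part rho r)%N /\ part sigma s = 0%N).
- case: mu hmu {cmu hs} => [hmu|]; last by right.
  have [|r_gt0] := posnP (part rho r); [by left | right => _].
  by case: (hmu erefl); lia.
- have [_] := cert_rows_nil hl s sigma prho r0; subst mu.
  rewrite [part [::] 0]part_default // addn0.
  case: r r0 hs {hmu} => [r0 hs _|r _ _ ->] //.
  by rewrite JM_rows0_bottom // part_bottom0 ?hs // r0 !addn0.
- exact: (cert_rows hl cmu prho h).2.
Qed.

(* If mu is empty and r = 0, the first bottom row plays the part of row r+1; it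
   has the length s that a new row above it requires iff sigma_(s+1) = 0. *)
Lemma JM_cons_sigma0 x s sigma : is_JM l (x :: bottom_parts l s sigma) ->
    rowres l (x :: bottom_parts l s sigma) 0 =
      rowres l (x :: bottom_parts l s sigma) 1 ->
  part sigma s = 0%N.
Proof.
move=> jm; have [//|sig_gt0] := posnP (part sigma s).
have [cb col0 part0] := cert_bottom hl s sigma.
have pb := cert_partition cb.
have partb i : (i < 2)%N -> part (bottom_parts l s sigma) i = s.+1.
  move=> i2; rewrite /part nth_cat size_nseq nth_nseq.
  have -> // : (i < part sigma s * l)%N.
  by apply: leq_trans (leq_pmull l sig_gt0); lia.
have colS c : (c < s.+1)%N -> (c < x)%N ->
    colres l (x :: bottom_parts l s sigma) c = s%:R.
  by move=> cs cx; rewrite colres_cons // (cert_col cb cs) col0 -natr1 addrK.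
move: jm; move: (bottom_parts l s sigma) cb col0 part0 pb partb colS => b.
move=> cb col0 part0 pb partb colS jm.
rewrite rowres_cons0 rowres_consS /rowres partb // subr0 -natr1 addrK => ex.
have := jm.1; rewrite is_partition_cons partb // => /and3P[sx _ _].
have [d ed] : exists d, (x - s.+1)%N = (l.-1 + d * l)%N.
  apply: Zl_eqN1; rewrite natrB // ex -natr1 opprD addNKr //.
(* The box (0, s) has a divisible hook. The box (0, s+1) is alone in its column, with residue s+1,
   and row 2, still of length s+1, has residue s-1; both differ from s, against the JM condition. *)
have [|||||] := @JM_residue _ 0 s 2 s.+1 jm.
- by rewrite part_cons0.
- by rewrite part_cons0; lia.
- by rewrite !part_consS partb.
- by rewrite rowres_cons0 colS.
- rewrite rowres_cons0 ex colres_cons; last by lia.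
  have -> : colres l b s.+1 = s%:R + 1 + 1.
    rewrite /colres; have := ltn_part 0 s.+1 pb.
    by rewrite partb // ltnn; case: height => // _; rewrite subr0 -!natr1.
  by rewrite addrK => /esym/eqP; rewrite (negPf (Zl_add1_neq _)).
- rewrite !rowres_consS colS // /rowres partb // -natr1 addrK => /eqP.
  by rewrite -subr_eq0 addrAC subrr add0r oppr_eq0 oner_eq0.
Qed.

(** R_0 = R_1 makes the excess of x over the next row equal to l-1 + d l, so the new first part of
    [rho] is rho_1 + d. *)
Lemma approx_cons x la mu r s rho sigma : is_JM l (x :: la) ->
    rowres l (x :: la) 0 = rowres l (x :: la) 1 ->
    JM_approx l la mu r s rho sigma ->
  exists rho', JM_approx l (x :: la) mu r.+1 s rho' sigma.
Proof.
move=> jm ex ap; have la0 : part la 0 =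
    (s + part mu 0 + r * l.-1 + part rho 0 * l)%N.
  apply: (part0_approx ap) => emu er.
  have := ap.2.2; rewrite -/(JM_rows l mu r s rho sigma).
  case: (ap.2.1 emu) => [|//]; subst mu r => rho0.
  rewrite JM_rows0_bottom // => ela.
  by subst la; apply: JM_cons_sigma0 jm ex.
have := jm.1; rewrite is_partition_cons => /and3P[lex _ pla].
have [d ed] : exists d, (x - part la 0)%N = (l.-1 + d * l)%N.
  apply: Zl_eqN1; move: ex.
  rewrite rowres_cons0 rowres_consS natrB // /rowres subr0 => ->.
  by rewrite addrAC subrr add0r.
case: ap => [[cmu hrow hcol [prho szr psig szs]] [hmu ela]].
have [prho' szr' rho0' rhoS'] := consp_spec prho (leq_addr d (part rho 0)).
exists (consp (part rho 0 + d) rho); split; [split|split] => //.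
- by split => //; apply: leq_trans szr' _.
- by rewrite rhoS'.
rewrite -/(JM_rows _ _ _ _ _ _) (JM_rows_cons _ _ _ _ hl1 rhoS') rho0'.
congr (_ :: _) => //.
by rewrite -[x](subnKC lex) ed la0 mulSn mulnDl; ring.
Qed.

Lemma size_JM_rows_nil r rho : (0 < part rho r)%N -> is_partition rho ->
  size (JM_rows l [::] r 0 rho [::]) = r.+1 /\
  part (JM_rows l [::] r 0 rho [::]) r = (part rho r * l)%N.
Proof.
elim: r rho => [|r IH] rho r_gt0 prho.
  by rewrite JM_rows0_nil //=; left; rewrite muln_gt0 r_gt0 ltnW.
have er i : part rho i.+1 = part (behead rho) i by rewrite part_behead.
rewrite (@JM_rows_cons l [::] r _ (behead rho) rho _ hl1 er) part_consS /= er.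
by have [|//|-> ->] := IH (behead rho); rewrite -?er // is_partition_behead.
Qed.

(** Counterpart of [JM_cons_sigma0] for columns: it rules out the case excluded in
    [JM_rows_addcol]. *)
Lemma JM_addcol_rho0 n r rho : is_partition rho ->
    is_JM l (addcol n (JM_rows l [::] r 0 rho [::])) -> n%:R = -1 :> 'Z_l ->
  part rho r = 0%N.
Proof.
move=> prho jm en; have [//|r_gt0] := posnP (part rho r).
have core0 : is_core l [::] by split => // a c; rewrite /box part_default.
have [|] := @cert_rows l hl [::] r 0 rho [::] core0 prho.
  by move=> _; split.
move=> cla _; have pla := cert_partition cla.
have [szla partla] := size_JM_rows_nil r_gt0 prho.
move: (JM_rows _ _ _ _ _ _) jm cla pla szla partla => la jm cla pla szla partla.
have l_part : (l <= part la r)%N by rewrite partla leq_pmull.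
have [d ed] := Zl_eqN1 en.
have n_gt0 : (0 < n)%N by rewrite ed predl_Ml_gt0.
have rowE : rowres l (addcol n la) r = 1 - r%:R.
  by rewrite rowres_addcol ?szla ?ltn_addr // /rowres partla Zl_Ml //; ring.
have col0E : colres l (addcol n la) 0 = 1 - r%:R.
  by rewrite colres_addcol0 // en /colres height0 // szla -natr1; ring.
(* The hook of (r, 0) is divisible, but those of (r, 2), in a column of height r+1, and of (r+1, 0),
   in a row of length 1, are not. *)
have [|||||] := @JM_residue _ r 0 r.+1 2 jm.
- by rewrite part_addcol //; lia.
- by rewrite part_addcol // szla ltn_addr //; lia.
- by rewrite part_addcol // szla; lia.
- by rewrite rowE col0E.
- have h1 : height la 1 = r.+1.
    apply/eqP; rewrite eqn_leq -[in X in X && _]szla count_size /=.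
    by rewrite -[(r < _)%N]ltn_part //; lia.
  rewrite rowE colres_addcolS /colres h1 -natr1 -[r.+1%:R]natr1 => /esym/eqP.
  have -> : 1 + 1 - (r%:R + 1) + 1 = 1 - r%:R + 1 :> 'Z_l by ring.
  by rewrite (negPf (Zl_add1_neq _)).
- rewrite col0E rowres_addcol //; last by rewrite szla; lia.
  rewrite /rowres part_default ?szla // -natr1 => /esym/eqP.
  have -> : 1 - r%:R = 0 - (r%:R + 1) + 1 + 1 :> 'Z_l by ring.
  by rewrite (negPf (Zl_add1_neq _)).
Qed.

Lemma approx_addcol n la mu r s rho sigma : is_JM l (addcol n la) ->
    n%:R = -1 :> 'Z_l -> JM_approx l la mu r s rho sigma ->
  exists sigma', JM_approx l (addcol n la) mu r s.+1 rho sigma'.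
Proof.
move=> jm en ap; have [d ed] := Zl_eqN1 en.
case: ap => [[cmu hrow hcol [prho szr psig szs]] [hmu ela]].
have [psig' szs' sig0' sigS'] := consp_spec psig (leq_addr d (part sigma 0)).
exists (consp (part sigma 0 + d) sigma); split; [split|split] => //.
- by split => //; apply: leq_trans szs' _.
- by rewrite sigS'.
rewrite -/(JM_rows _ _ _ _ _ _) (JM_rows_addcol hl1 cmu.1 sigS').
  by rewrite sig0' addKn -ed ela.
case: mu cmu hrow hcol hmu ela => //= cmu _ _ /(_ erefl) hmu ela.
have [bnil|//] := eqVneq (bottom_parts l s sigma) [::].
(* If rho_(r+1) > 0, then sigma_(s+1) = 0, and the absence of bottom parts forces s = 0 and [sigma]
   empty. *)
rewrite /=; apply/eqP; have [//|r_gt0] := posnP (part rho r).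
have sig_s : part sigma s = 0%N by case: hmu; lia.
have s0 : s = 0%N by have := part_bottom0 hl sig_s; rewrite bnil part_default.
subst s; have sig_nil : sigma = [::].
  case: (sigma) psig sig_s => // y sig; rewrite is_partition_cons part_cons0.
  by move=> /and3P[_ y_gt0 _] y0; rewrite y0 in y_gt0.
subst sigma; apply: JM_addcol_rho0 prho _ en.
rewrite -/(JM_rows _ _ _ _ _ _) in ela.
by rewrite -ela.
Qed.

(** Every hook length is positive and at most mu_1 + len(mu) - 1 < l. *)
Lemma is_core_small mu :
  is_partition mu -> (part mu 0 + size mu <= l)%N -> is_core l mu.
Proof.
move=> pmu small; split=> // a c bac; rewrite gtnNdvd //.
  by rewrite /hook ltn_addr // subn_gt0.
have := hookE pmu bac; have := part_leq pmu (leq0n a).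
by have : (height mu c <= size mu)%N := count_size _ _; lia.
Qed.

(** Row a meets columns 0 and 1, one of which has a residue other than R_a; column c meets rows 0
    and 1, one of which has a residue other than C_c. With a divisible hook at (a, c), these two
    boxes would violate the JM condition. *)
Lemma JM_nondiv la a c : is_JM l la ->
    rowres l la 0 != rowres l la 1 -> colres l la 0 != colres l la 1 ->
    (c < part la a)%N -> (c < part la 1)%N -> (1 < part la a)%N ->
  rowres l la a != colres l la c.
Proof.
move=> jm nr nc ca c1 a1; apply/eqP => e.
have c0 : (c < part la 0)%N by apply: leq_trans c1 (part_leq jm.1 _).
have [y y2 ny] : exists2 y, (y < 2)%N & rowres l la a != colres l la y.
  have [e0|] := eqVneq (rowres l la a) (colres l la 0); last by exists 0%N.
  by exists 1%N; rewrite // e0.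
have [x x2 nx] : exists2 x, (x < 2)%N & rowres l la x != colres l la c.
  have [e0|] := eqVneq (rowres l la 0) (colres l la c); last by exists 0%N.
  by exists 1%N; rewrite // -e0 eq_sym.
have ya : (y < part la a)%N by lia.
have xc : (c < part la x)%N by case: x x2 {nx} => [|[]].
by case: (JM_residue jm ca ya xc e) => /eqP; [apply/negP: ny | apply/negP: nx].
Qed.

End Converse.

(** * Partitions without removable row or column *)

Lemma consp1 q : [/\ is_partition (consp q [::]), size (consp q [::]) <= 1,
  part (consp q [::]) 0 = q & part (consp q [::]) 1 = 0].
Proof.
have [//|p sz p0 ps] := @consp_spec q [::] isT; first by split.
Qed.

Section Base.

Variables (l : nat) (hl : 2 < l).
Let hl1 : 1 < l := ltnW hl.

Definition approximable la :=
  exists mu r s rho sigma, JM_approx l la mu r s rho sigma.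

Lemma approximable_nil mu r s p q :
    is_core l mu ->
    part mu 0 - part mu 1 < l.-1 ->
    height mu 0 - height mu 1 < l.-1 ->
    (mu = [::] -> part (consp p [::]) r = 0 \/ part (consp q [::]) s = 0) ->
  approximable (JM_rows l mu r s (consp p [::]) (consp q [::])).
Proof.
move=> cmu h1 h2 h3; have [pp sp _ _] := consp1 p; have [pq sq _ _] := consp1 q.
exists mu, r, s, (consp p [::]), (consp q [::]); split; [|by split].
rewrite !part_transpose ?cmu.1 //; split => //; split => //.
  by apply: leq_trans sp _.
by apply: leq_trans sq _.
Qed.

Lemma is_core_nil : is_core l [::].
Proof. by split => // a c; rewrite /box part_default. Qed.

Lemma approximable_empty r s p q :
    part (consp p [::]) r = 0 \/ part (consp q [::]) s = 0 ->
  approximable (JM_rows l [::] r s (consp p [::]) (consp q [::])).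
Proof.
move=> h; apply: approximable_nil => //; first exact: is_core_nil.
  by rewrite /part /=; lia.
by rewrite /height /=; lia.
Qed.

Lemma approximable_column e q : e < l.-1 -> approximable (nseq (e + q * l) 1).
Proof.
move=> el; have [_ _ q0 _] := consp1 q.
have -> : nseq (e + q * l) 1 =
    JM_rows l (nseq e 1) 0 0 (consp 0 [::]) (consp q [::]).
  case: e {el} => [|e]; first by rewrite JM_rows0_bottom // bottom_parts0 q0.
  rewrite JM_rows0_cons; last first.
    exact: (is_partition_addcol e.+1 (isT : is_partition [::])).
  by rewrite bottom_parts0 q0 nseqD /= part_default // mul0n addn0 map_nseq.
have pe := is_partition_addcol e (isT : is_partition [::]).
apply: approximable_nil.
- apply: is_core_small => //.
  by rewrite size_nseq /part nth_nseq; case: ifP; lia.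
- by rewrite /part !nth_nseq; do 2 case: ifP; lia.
- by rewrite /height !count_nseq /=; lia.
- by left.
Qed.

Lemma approximable_row d p :
  0 < d + p * l -> d < l.-1 -> approximable [:: d + p * l].
Proof.
move=> dp_gt0 dl; have [_ _ p0 _] := consp1 p.
have -> : [:: d + p * l] =
    JM_rows l (consp d [::]) 0 0 (consp p [::]) (consp 0 [::]).
  case: d dp_gt0 {dl} => [|d] dp_gt0.
    by rewrite JM_rows0_nil ?bottom_parts0 p0 //; left.
  by rewrite JM_rows0_cons // bottom_parts0 p0.
have [pd sd d0 d1] := consp1 d.
apply: approximable_nil => //.
- by apply: is_core_small => //; rewrite d0; lia.
- by rewrite d0; lia.
- have : height (consp d [::]) 0 <= size (consp d [::]) := count_size _ _.
  by lia.
- by right.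
Qed.

(** [big] is [la] without its first row and column. [JM_nondiv] applies to the boxes outside the two
    ends, as the residues are unchanged. In the shortened ends, of row 0 beyond row 1 and of column
    0 beyond column 1, hooks are at most d or e, hence below l. *)
Lemma is_core_base d e p q big :
    let B := addcol (e + q * l) big in
    let m := part B 0 + d in
    let la := (m + p * l) :: B in
    is_partition big -> d < l.-1 -> e < l.-1 -> 0 < size B -> 1 < m + p * l ->
    is_JM l la -> rowres l la 0 != rowres l la 1 ->
    colres l la 0 != colres l la 1 ->
  is_core l (m :: addcol e big).
Proof.
move=> B m la pbig dl el sB la2 jm nr nc.
have eB : B = addcol e big ++ nseq (q * l) 1.
  by rewrite /B /addcol nseqD catA.
have pmu' := is_partition_addcol e pbig.
have pB : is_partition B := is_partition_addcol _ pbig.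
have m_gt0 : 0 < m by rewrite ltn_addr // size_gt_part.
have le0 : part (addcol e big) 0 <= part B 0.
  by rewrite !part_addcol // leq_add2l; case: (0 < size big + e) / posnP; lia.
have pmu : is_partition (m :: addcol e big).
  by rewrite is_partition_cons m_gt0 pmu' (leq_trans le0) ?leq_addr.
split => // a c bac.
have [am|am] := ltnP a (size (addcol e big)).+1; last first.
  by move: bac; rewrite /box part_default.
have cm : c < m.
  by apply: leq_trans bac _; rewrite -[m]/(part (m :: addcol e big) 0) part_leq.
have partS i : i < size (addcol e big) -> part la i.+1 = part (addcol e big) i.
  by move=> isz; rewrite part_consS eB /part nth_cat isz.
have ca : c < part la a.
  case: a am bac {cm} => [_|a am]; rewrite /box.
    by rewrite !part_cons0 => cm; rewrite ltn_addr.
  by rewrite part_consS partS.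
have [/andP[c1 a1]|small] := boolP ((c < part la 1) && (1 < part la a)).
  rewrite dvd_hook // -(rowres_extend hl m p q am) -(colres_extend hl _ p q cm).
  by rewrite -eB; apply: JM_nondiv.
have := hookE pmu bac; have : 0 < hook (m :: addcol e big) a c.
  by rewrite /hook ltn_addr // subn_gt0.
move: (hook _ _ _) => h h_gt0 eh; rewrite gtnNdvd //.
case: a am bac small ca eh => [|a] am bac small ca.
  have cB : part B 0 <= c.
    by move: small; rewrite part_cons0 la2 andbT -leqNgt part_consS.
  have h0 : height (addcol e big) c = 0.
    move: (ltn_part 0 c pmu'); rewrite ltnNge (leq_trans le0 cB).
    by case: height.
  by rewrite height_cons h0 cm part_cons0 /m; lia.
rewrite part_consS.
have aB : part la a.+1 <= part B 0 by rewrite part_consS part_leq.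
have c1 : c < part la 1 by apply: leq_trans ca _; rewrite part_consS.
have a1 : part la a.+1 <= 1 by move: small; rewrite c1 /= -leqNgt.
have c0 : c = 0 by lia.
subst c; rewrite height0 //= size_addcol -partS //.
have : size big <= a.
  rewrite leqNgt -size_gt_part // -leqNgt; move: a1.
  rewrite partS // part_addcol //; move: am; rewrite ltnS size_addcol => ->.
  by rewrite addn1.
lia.
Qed.

Lemma approximable_base la : is_JM l la -> 0 < size la ->
    rowres l la 0 != rowres l la 1 -> colres l la 0 != colres l la 1 ->
  approximable la.
Proof.
move=> jm la_gt0 nr nc; have pla := jm.1.
have [n [la' [pla' ela]]] := addcolP pla.
have [q [e [en el]]] : exists q e, n = e + q * l /\ e < l.-1.
  apply: (Zl_neqN1 hl); apply: contra nc => /eqP n1.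
  by rewrite ela colres_addcolS colres_addcol0 // n1 opprK.
case: la' pla' ela => [|x big] pla' ela.
  by rewrite ela addcol_nil en; apply: approximable_column.
have pbig : is_partition big := is_partition_behead pla'.
move: nr nc jm pla {la_gt0}; rewrite ela addcol_cons.
set B := addcol n big => nr nc jm pla.
have := pla; rewrite is_partition_cons => /and3P[lex _ pB].
have [p [d [ed dl]]] : exists p d, x.+1 - part B 0 = d + p * l /\ d < l.-1.
  apply: (Zl_neqN1 hl); apply: contra nr => /eqP.
  rewrite rowres_cons0 rowres_consS natrB // /rowres subr0 => h.
  by rewrite -subr_eq0 opprB addrCA h subrr.
have {ed} ex : x.+1 = part B 0 + d + p * l by lia.
have x_gt0 : 0 < x by move: pla'; rewrite is_partition_cons => /and3P[].
have [sB|sB] := posnP (size B).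
  rewrite (size0nil sB) /= in ex *; rewrite ex.
  by apply: approximable_row => //; lia.
have B_gt0 : 0 < part B 0 by rewrite size_gt_part.
have [_ _ p0 p1] := consp1 p; have [_ _ q0 q1] := consp1 q.
have eB : B = addcol e big ++ nseq (q * l) 1.
  by rewrite /B en /addcol nseqD catA.
(* The two cases in which reducing the first row and column modulo l would
   give mu = (l-1) or mu = (1^(l-1)), which violate the bounds on mu. *)
have [exc1|nexc1] := boolP [&& size big == 0, e == 0 & d == l.-2].
  case/and3P: exc1 => /eqP/size0nil big0 /eqP e0 /eqP ed.
  have B1 : part B 0 = 1.
    apply/eqP; rewrite eqn_leq B_gt0 andbT /B big0 addcol_nil.
    by rewrite /part nth_nseq; case: ifP.
  (* The first row, of length l-1 + p l, is the single row counted by r = 1; the q l ones below come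
     from sigma_1. *)
  have -> : x.+1 :: B = JM_rows l [::] 1 0 (consp p [::]) (consp q [::]).
    have es i : part (consp p [::]) i.+1 = part [::] i.
      by case: (p) => [|p']; case: i.
    rewrite (JM_rows_cons _ _ _ _ hl1 es) JM_rows0_bottom // bottom_parts0 q0.
    rewrite eB big0 e0 p0 ex B1 ed mul1n; congr (_ :: _).
    by rewrite add0n [part [::] 0]part_default //; lia.
  by apply: approximable_empty; left.
have [exc2|nexc2] := boolP [&& part B 0 == 1, d == 0 & e == l.-2].
  case/and3P: exc2 => /eqP B1 /eqP d0 /eqP ee.
  have big0 : big = [::].
    apply/size0nil/eqP; rewrite -leqn0 leqNgt -size_gt_part // -leqNgt.
    have sBn : 0 < size big + n by rewrite -size_addcol.
    by move: B1; rewrite part_addcol // sBn /=; lia.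
  (* The first column, of height l-1 + q l, is counted by s = 1, and its first row is the one that
     grows by p l. *)
  have -> : x.+1 :: B = JM_rows l [::] 0 1 (consp p [::]) (consp q [::]).
    have es i : part (consp q [::]) i.+1 = part [::] i.
      by case: (q) => [|q']; case: i.
    have eb : bottom_parts l 1 (consp q [::]) = nseq (l.-1 + q * l) 1.
      by rewrite (bottom_partsS _ _ es) bottom_parts0 q0 subn0 addcol_nil.
    have el1 : l.-1 + q * l = (l.-2 + q * l).+1 by lia.
    rewrite JM_rows0_nil eb el1; last by right.
    by rewrite ex B1 d0 p0 addn0 /B big0 addcol_nil en ee.
  by apply: approximable_empty; right.
set m := part B 0 + d.
have cmu : is_core l (m :: addcol e big).
  rewrite /m /B en; apply: (@is_core_base d e p q big) => //.
  all: rewrite -?en -/B -?ex //.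
have -> : x.+1 :: B =
    JM_rows l (m :: addcol e big) 0 0 (consp p [::]) (consp q [::]).
  rewrite JM_rows0_cons ?cmu.1 // bottom_parts0 p0 q0 ex add0n -/m.
  by rewrite (eq_map (g := id)) ?map_id // eB.
have pmu' := is_partition_addcol e pbig.
apply: approximable_nil => //.
(* The difference mu_1 - mu_2 is d, except that it is d+1 when [mu] has a single row; [nexc1] then
   excludes d = l-2. *)
- rewrite part_cons0 part_consS; have [s0|s_gt0] := posnP (size (addcol e big)).
    move: s0 nexc1; rewrite size_addcol => /eqP; rewrite addn_eq0.
    case/andP => /eqP big0 /eqP e0; rewrite big0 e0 /= => nd.
    have B1 : part B 0 <= 1.
      by rewrite /B (size0nil big0) addcol_nil /part nth_nseq; case: ifP.
    rewrite /m; lia.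
  have -> : part (addcol e big) 0 = part B 0 by rewrite eB /part nth_cat s_gt0.
  by rewrite /m addKn.
(* Likewise the columns differ by e, or by e+1 when m = 1, where [nexc2] excludes e = l-2. *)
rewrite !height_cons (height0 pmu') size_addcol height_addcolS height0 //.
have m_gt0 : 0 < m by rewrite ltn_addr.
rewrite m_gt0; move: nexc2; rewrite /m.
by case: (ltnP 1 (part B 0 + d)) => h1 nexc2 /=; lia.
Qed.

End Base.

(** * Induction on the number of boxes *)

Lemma JM_approximable l la : 2 < l -> is_JM l la -> approximable l la.
Proof.
move=> hl; have [N] := ubnP (sumn la); elim: N la => // N IH la laN jm.
have [la0|la_gt0] := posnP (size la).
  have -> : la = JM_rows l [::] 0 0 (consp 0 [::]) (consp 0 [::]).
    by rewrite (size0nil la0) JM_rows0_bottom // bottom_parts0.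
  by apply: (approximable_empty hl); left.
(* Residues extend beyond the diagram: for a single row of length x, R_1 = -1, so the test reads x =
   -1. *)
have [er|nr] := eqVneq (rowres l la 0) (rowres l la 1).
  case: la la_gt0 er jm laN => // x la _ er jm laN.
  have x_gt0 : 0 < x by have := jm.1; rewrite is_partition_cons => /and3P[].
  have [|mu [r [s [rho [sigma ap]]]]] := IH la _ (JM_behead jm).
    by move: laN => /=; lia.
  have [rho' ap'] := approx_cons hl jm er ap.
  by exists mu, r.+1, s, rho', sigma.
have [ec|nc] := eqVneq (colres l la 0) (colres l la 1); last first.
  exact: approximable_base.
have [n [la' [pla' ela]]] := addcolP jm.1; subst la.
have en : (n%:R = -1 :> 'Z_l)%R.
  move: ec; rewrite colres_addcolS colres_addcol0 //.
  by move/addrI/(congr1 (@GRing.opp _)); rewrite opprK.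
have [d ed] := Zl_eqN1 hl en.
have [|mu [r [s [rho [sigma ap]]]]] := IH la' _ (JM_addcol hl pla' jm).
  (* The removed column is nonempty even for empty [la'], because n = l-1 + d l > 0. *)
  have : sumn la' <= sumn (map S la') by elim: (la') => //= x t; lia.
  have := predl_Ml_gt0 hl d.
  by move: laN; rewrite /addcol sumn_cat sumn_nseq; lia.
have [sigma' ap'] := approx_addcol hl jm en ap.
by exists mu, r, s.+1, rho, sigma'.
Qed.

Theorem theorem3p2 (l : nat) (hl : 2 < l) :
  (forall (la mu : seq nat) (r s : nat) (rho sigma : seq nat),
      JM_approx l la mu r s rho sigma -> is_JM l la) /\
  (forall la : seq nat, is_JM l la ->
      exists (mu : seq nat) (r s : nat) (rho sigma : seq nat),
        JM_approx l la mu r s rho sigma).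
Proof.
split; first by move=> *; apply: (approx_JM hl); eassumption.
by move=> la; apply: JM_approximable.
Qed.
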